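(* Let $p$ be a prime number and let $t\in\mathbb{C}$ with $|t|<1$. Then $$f_{L_y}(t,p)=\frac{\mathcal{B}_2(t)}{2p}-\frac{\mathcal{B}_{p+1}(t)}{p(p+1)},$$ where $f_{L_y}(t,p)=\sum_{k=0}^{\infty}L_k(p)\,t^k$ is the generating function of the numbers $L_k(p)$ of $k$-ary Lyndon words of length $p$, and $\mathcal{B}_n(t)$ denotes the $n$-th Apostol-Bernoulli number with parameter $t$.
   Context: For integers $k\ge 0$ and $n\ge 1$, the number of $k$-ary Lyndon words of length $n$ is given by $L_k(n)=\frac1n\sum_{d\mid n}\mu\left(\frac nd\right)k^d$, where $\mu$ is the Möbius function; this formula is taken as the definition of $L_k(n)$. For a prime $p$, $f_{L_y}(t,p)=\sum_{k=0}^{\infty}L_k(p)t^k$. The Apostol-Bernoulli numbers $\mathcal{B}_n(z)$, for $z\in\mathbb{C}$, $z\ne 1$, are defined by the expansion about $u=0$ $$\frac{u}{ze^{u}-1}=\sum_{n=0}^{\infty}\mathcal{B}_n(z)\frac{u^n}{n!}.$$ Each $\mathcal{B}_n(z)$ is a rational function of $z$ whose only possible pole is $z=1$. *)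

(* Defs.v *)
(* Stdlib/Coquelicot reals and complex numbers; MathComp is used only for
   primes and divisors of natural numbers. *)
From mathcomp Require Import all_boot.
From Stdlib Require Import Reals ClassicalEpsilon.
From Coquelicot Require Import Coquelicot.

Definition mobius (n : nat) : Z :=
  if all (fun q => logn q n == 1%nat) (primes n)
  then ((-1) ^ Z.of_nat (size (primes n)))%Z
  else 0%Z.

Definition lyndon (k n : nat) : R :=
  (/ INR n *
   \big[Rplus/0]_(d <- divisors n) (IZR (mobius (n %/ d)%nat) * INR k ^ d))%R.

Definition Cexp (u : C) : C :=
  (exp (fst u) * cos (snd u), exp (fst u) * sin (snd u))%R.

(* The expansion is required to hold, as a convergent series, on some complex
   neighbourhood of 0.  For z <> 1 the denominator is nonzero near 0. *)
Definition apostol_bernoulli_expansion (z : C) (B : nat -> C) : Prop :=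
  locally (RtoC 0) (fun u : C =>
    is_pseries (K := C_AbsRing) (V := C_NormedModule)
      (fun n => B n / RtoC (INR (Factorial.fact n)))%C u
      (u / (z * Cexp u - 1))%C).

(* The (unique, for z <> 1) coefficient sequence of the expansion, selected by
   choice; the value at z = 1 is a default without meaning. *)
Definition apostol_bernoulli (n : nat) (z : C) : C :=
  epsilon (inhabits (fun _ : nat => RtoC 0)) (apostol_bernoulli_expansion z) n.

(* The generating function as a relation: the series converges at t with
   sum s. *)
Definition is_lyndon_gf (t : C) (p : nat) (s : C) : Prop :=
  is_pseries (K := C_AbsRing) (V := C_NormedModule)
    (fun k => RtoC (lyndon k p)) t s.

(* Main.v *)
(* Writing S_n = sum_k k^n t^k for |t| < 1, expanding 1 / (1 - t e^u) = sum_k t^k e^(k u)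
   in powers of u and interchanging the sums gives
   u / (t e^u - 1) = - sum_n S_n u^(n+1) / n!, that is B_(n+1)(t) = - (n+1) S_n, by
   uniqueness of power series coefficients.  Since p L_k(p) = k^p - k for p prime, the
   generating function is (S_p - S_1) / p. *)

Require Import Defs.
From mathcomp Require Import all_boot.
From Stdlib Require Import Reals Lra ClassicalEpsilon.
From Coquelicot Require Import Coquelicot.

Local Open Scope C_scope.

Local Notation C_series := (is_series (K := C_AbsRing) (V := C_NormedModule)).
Local Notation C_pseries := (is_pseries (K := C_AbsRing) (V := C_NormedModule)).
Local Notation C_sum := (sum_n (G := C_AbelianMonoid)).

(** * Series of complex numbers *)

Lemma RtoC_neq_0 (x : R) : x <> 0%R -> RtoC x <> 0.
Proof. by move=> h []. Qed.

Lemma pow_n_C (x : C) (n : nat) : pow_n (K := C_AbsRing) x n = x ^ n.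
Proof. by elim: n => [|n IH] //=; rewrite IH. Qed.

Lemma C_pseriesE (a : nat -> C) (x l : C) :
  C_pseries a x l <-> C_series (fun n => x ^ n * a n) l.
Proof.
split; apply: is_series_ext => n; by rewrite pow_n_C.
Qed.

Lemma C_series_of_bound (a : nat -> C) (l : C) (b : nat -> R) :
  (forall n, Cmod (C_sum a n - l) <= b n)%R -> is_lim_seq b 0%R -> C_series a l.
Proof.
move=> Hab Hb.
apply/filterlim_locally_ball_norm => eps.
move/is_lim_seq_spec: Hb => /(_ eps) [N HN].
exists N => n Hn; apply: Rle_lt_trans (Hab n) _.
have := HN n Hn; rewrite Rminus_0_r; exact: Rle_lt_trans (Rle_abs _).
Qed.

(** The triangle inequality bounds every partial sum, and the bound passes to the limit by
    continuity of the modulus. *)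
Lemma C_series_Cmod_le (a : nat -> C) (l : C) (b : nat -> R) (m : R) :
  (forall n, Cmod (a n) <= b n)%R -> C_series a l -> is_series b m ->
  (Cmod l <= m)%R.
Proof.
move=> Hab Ha Hb.
apply: (is_lim_seq_le (fun n => Cmod (C_sum a n)) (sum_n b) (Cmod l) m).
- move=> n; apply: Rle_trans (norm_sum_n_m (V := C_NormedModule) a 0 n) _.
  by apply: sum_n_m_le => k; exact: Hab.
- exact: (filterlim_comp _ _ _ _ (norm (V := C_NormedModule)) _ _ _ Ha
    (filterlim_norm (V := C_NormedModule) l)).
- exact: Hb.
Qed.

Lemma C_series_geom (q : C) : (Cmod q < 1)%R -> C_series (fun k => q ^ k) (/ (1 - q)).
Proof.
move=> hq.
have nz : 1 - q <> 0.
  move=> e; have e1 : q = 1 by rewrite -[q]/(q) -(Cplus_0_r q) -e; ring.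
  by rewrite e1 Cmod_1 in hq; lra.
have S n : C_sum (fun k => q ^ k) n = (1 - q ^ n.+1) / (1 - q).
  elim: n => [|n IH]; first by rewrite sum_O /=; field.
  by rewrite sum_Sn IH /plus /=; field.
apply: (C_series_of_bound _ _ (fun n => Cmod q ^ n * (Cmod q / Cmod (1 - q)))%R).
  move=> n; rewrite S.
  have -> : (1 - q ^ n.+1) / (1 - q) - / (1 - q) = - (q ^ n * (q / (1 - q))).
    by rewrite /=; field.
  rewrite Cmod_opp Cmod_mult Cmod_pow Cmod_div //; exact: Rle_refl.
rewrite -(Rmult_0_l (Cmod q / Cmod (1 - q))%R).
apply: (is_lim_seq_scal_r _ _ (Finite 0)).
by apply: is_lim_seq_geom; rewrite Rabs_pos_eq //; exact: Cmod_ge_0.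
Qed.

(** * The complex exponential and its Taylor remainder *)

Lemma Cexp_plus (u v : C) : Cexp (u + v) = Cexp u * Cexp v.
Proof.
case: u => a b; case: v => c d; rewrite /Cexp /Cmult /=.
by rewrite exp_plus cos_plus sin_plus; congr pair; ring.
Qed.

Lemma Cexp_0 : Cexp 0 = 1.
Proof. by rewrite /Cexp /= exp_0 cos_0 sin_0 /RtoC; congr pair; ring. Qed.

Lemma Cexp_nat_mult (u : C) (k : nat) : Cexp (RtoC (INR k) * u) = Cexp u ^ k.
Proof.
elim: k => [|k IH]; first by rewrite Cmult_0_l Cexp_0.
rewrite S_INR RtoC_plus Cpow_S -IH -Cexp_plus; congr Cexp; ring.
Qed.

Lemma exp_le (x y : R) : (x <= y)%R -> (exp x <= exp y)%R.
Proof.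
case=> [h|->]; [exact: Rlt_le (exp_increasing _ _ h) | exact: Rle_refl].
Qed.

Lemma Re_le_Cmod (z : C) : (Re z <= Cmod z)%R.
Proof. exact: Rle_trans (Rle_abs _) (re_le_Cmod z). Qed.

(** Since $\cos^2+\sin^2=1$, the modulus of $e^u$ is $e^{\mathrm{Re}\,u}$. *)
Lemma Cmod_Cexp_le (u : C) : (Cmod (Cexp u) <= exp (Cmod u))%R.
Proof.
have -> : Cmod (Cexp u) = exp (Re u).
  rewrite /Cmod /Cexp /=.
  have -> : (exp u.1 * cos u.2 * (exp u.1 * cos u.2 * 1) +
     exp u.1 * sin u.2 * (exp u.1 * sin u.2 * 1))%R = (exp u.1 ^ 2)%R.
    have := sin2_cos2 u.2; rewrite /Rsqr => h.
    have -> : (exp u.1 ^ 2 = exp u.1 ^ 2 * (sin u.2 * sin u.2 + cos u.2 * cos u.2))%R.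
      by rewrite h; ring.
    ring.
  by rewrite sqrt_pow2 //; apply: Rlt_le; exact: exp_pos.
exact: exp_le (Re_le_Cmod u).
Qed.

Definition Cexp_taylor (w : C) (n : nat) : C :=
  C_sum (fun m => w ^ m / RtoC (INR (Factorial.fact m))) n.

(** Along the ray $s\mapsto sw$ the exponential becomes a function of a real variable, and each
    derivative only multiplies the constant [c] by [w]. *)
Lemma is_derive_Re_Cexp (c w : C) (s : R) :
  is_derive (fun s : R => Re (c * Cexp (RtoC s * w))) s
    (Re (c * w * Cexp (RtoC s * w))).
Proof. by rewrite /Cexp /=; auto_derive => //; rewrite /Rminus; ring. Qed.

Lemma Derive_n_Re_Cexp (c w : C) (n : nat) (s : R) :
  Derive_n (fun s : R => Re (c * Cexp (RtoC s * w))) n s =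
  Re (c * w ^ n * Cexp (RtoC s * w)).
Proof.
elim: n s => [|n IH] s; first by rewrite Cmult_1_r.
rewrite [LHS]/=.
rewrite (Derive_ext _ _ _ IH); apply: is_derive_unique.
have -> : c * w ^ n.+1 = c * w ^ n * w by rewrite Cpow_S; ring.
exact: is_derive_Re_Cexp.
Qed.

Lemma Re_minus (a b : C) : Re (a - b) = (Re a - Re b)%R.
Proof. by []. Qed.

(** The Lagrange form of the remainder concerns real-valued functions, so it is applied to
    $s\mapsto\mathrm{Re}(c\,e^{sw})$ on $[0,1]$. The factor [c] stays free so that a bound on the
    modulus can be recovered from it. *)
Lemma Re_Cexp_taylor_remainder (c w : C) (n : nat) :
  (Re (c * (Cexp w - Cexp_taylor w n)) <=
   Cmod c * (Cmod w ^ n.+1 / INR (Factorial.fact n.+1) * exp (Cmod w)))%R.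
Proof.
set f := fun s : R => Re (c * Cexp (RtoC s * w)).
have ex s k : ex_derive_n f k s.
  case: k => [//|k] /=.
  apply: (ex_derive_ext (fun s => Re (c * w ^ k * Cexp (RtoC s * w)))).
    by move=> s'; rewrite Derive_n_Re_Cexp.
  by eexists; exact: is_derive_Re_Cexp.
have [z [hz e]] := Taylor_Lagrange f n 0 1 Rlt_0_1 (fun s _ k _ => ex s k).
have F0 : (0 < INR (Factorial.fact n.+1))%R by exact: INR_fact_lt_0.
have e1 : f 1%R = Re (c * Cexp w) by rewrite /f; congr (Re (_ * Cexp _)); ring.
have eT : sum_f_R0 (fun m : nat =>
     ((1 - 0) ^ m / INR (Factorial.fact m) * Derive_n f m 0)%R) n =
     Re (c * Cexp_taylor w n).
  have term m : ((1 - 0) ^ m / INR (Factorial.fact m) * Derive_n f m 0)%R =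
     Re (c * (w ^ m / RtoC (INR (Factorial.fact m)))).
    rewrite Derive_n_Re_Cexp Cmult_0_l Cexp_0 Cmult_1_r Rminus_0_r pow1.
    have F := INR_fact_neq_0 m.
    by rewrite /Cdiv -RtoC_inv // Cmult_assoc re_scal_r; field.
  elim: n {e F0} => [|k IH]; first by rewrite /Cexp_taylor sum_O -term.
  rewrite tech5 IH term /Cexp_taylor sum_Sn.
  by rewrite -re_plus; congr Re; rewrite /plus /=; ring.
have -> : Re (c * (Cexp w - Cexp_taylor w n)) =
   (f 1 - Re (c * Cexp_taylor w n))%R.
  rewrite e1 -Re_minus; congr Re; ring.
rewrite e eT Derive_n_Re_Cexp Rminus_0_r pow1.
set r := Re _; set q := Re _.
(* The intermediate point [z] lies in $(0,1)$, hence $|zw|\le|w|$. *)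
have hq : (q <= Cmod c * (Cmod w ^ n.+1 * exp (Cmod w)))%R.
  apply: Rle_trans (Re_le_Cmod _) _.
  rewrite Cmod_mult Cmod_mult Cmod_pow Rmult_assoc.
  apply: Rmult_le_compat_l; first exact: Cmod_ge_0.
  apply: Rmult_le_compat_l; first exact: pow_le (Cmod_ge_0 _).
  apply: Rle_trans (Cmod_Cexp_le _) _.
  apply: exp_le; rewrite Cmod_mult Cmod_R Rabs_pos_eq; last lra.
  rewrite -{2}(Rmult_1_l (Cmod w)).
  by apply: Rmult_le_compat_r; [exact: Cmod_ge_0 | lra].
have -> : (r + 1 / INR (Factorial.fact n.+1) * q - r)%R =
  (/ INR (Factorial.fact n.+1) * q)%R by field; lra.
have -> : (Cmod c * (Cmod w ^ n.+1 / INR (Factorial.fact n.+1) * exp (Cmod w)) =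
  / INR (Factorial.fact n.+1) * (Cmod c * (Cmod w ^ n.+1 * exp (Cmod w))))%R.
  field; lra.
apply: Rmult_le_compat_l => //; exact: Rlt_le (Rinv_0_lt_compat _ F0).
Qed.

(** With the conjugate of the remainder [D] as the free factor, the real part is $|D|^2$; one factor
    $|D|$ then cancels unless [D] vanishes. *)
Lemma Cexp_taylor_remainder (w : C) (n : nat) :
  (Cmod (Cexp w - Cexp_taylor w n) <=
   Cmod w ^ n.+1 / INR (Factorial.fact n.+1) * exp (Cmod w))%R.
Proof.
set D := _ - _; set B := (_ * _)%R.
have B0 : (0 <= B)%R.
  apply: Rmult_le_pos; last exact: Rlt_le (exp_pos _).
  apply: Rdiv_le_0_compat (INR_fact_lt_0 _); exact: pow_le (Cmod_ge_0 _).
have := Re_Cexp_taylor_remainder (Cconj D) w n.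
rewrite -/D -/B Cmod_conj Cmult_comm -Cmod2_conj re_RtoC => h.
have [D0|<-] := Cmod_ge_0 D; last exact: B0.
by apply: (Rmult_le_reg_l (Cmod D)) => //; move: h; rewrite /= Rmult_1_r.
Qed.

(** For $x\ge 0$ a single term of the exponential series is at most a partial sum containing it. *)
Lemma pow_div_fact_le_exp (x : R) (n : nat) :
  (0 <= x)%R -> (x ^ n / INR (Factorial.fact n) <= exp x)%R.
Proof.
move=> x0; apply: Rle_trans (exp_ge_taylor x n x0).
case: n => [|n]; first exact: Rle_refl.
rewrite tech5 -[X in (X <= _)%R]Rplus_0_l; apply: Rplus_le_compat_r.
apply: cond_pos_sum => k.
by apply: Rdiv_le_0_compat (INR_fact_lt_0 _); exact: pow_le.
Qed.

(* Trading [|w|^n / n!] for [2^-n exp (2 |w|)] makes the decay in [n] uniform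
   in [w]. *)
Lemma Cexp_taylor_remainder_geom (w : C) (n : nat) :
  (Cmod (Cexp w - Cexp_taylor w n) <= (/ 2) ^ n.+1 * exp (3 * Cmod w))%R.
Proof.
apply: Rle_trans (Cexp_taylor_remainder w n) _.
have W0 := Cmod_ge_0 w.
have W2 : (0 <= 2 * Cmod w)%R by lra.
have h := pow_div_fact_le_exp _ n.+1 W2.
have -> : (3 * Cmod w = 2 * Cmod w + Cmod w)%R by ring.
rewrite exp_plus -Rmult_assoc; apply: Rmult_le_compat_r; first exact: Rlt_le (exp_pos _).
have -> : (Cmod w ^ n.+1 / INR (Factorial.fact n.+1) =
  (/ 2) ^ n.+1 * ((2 * Cmod w) ^ n.+1 / INR (Factorial.fact n.+1)))%R.
  rewrite /Rdiv -Rmult_assoc -Rpow_mult_distr; congr (_ ^ _ * _)%R; field.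
by apply: Rmult_le_compat_l => //; apply: pow_le; lra.
Qed.

(** * Power sums and their exponential generating function *)

Lemma exists_exp_radius (a : R) : (a < 1)%R -> exists2 r : R, (0 < r)%R & (a * exp r < 1)%R.
Proof.
(* The maximum with $1/2$ keeps [b] positive, so that [ln b] is meaningful even when $a\le 0$. The
   radius $-\ln(b)/2$ then gives $b\,e^r=\sqrt b<1$. *)
move=> a1; set b := Rmax a (/ 2).
have b1 : (b < 1)%R by apply: Rmax_lub_lt; lra.
have b2 : (/ 2 <= b)%R by exact: Rmax_r.
have l0 : (ln b < 0)%R by rewrite -ln_1; apply: ln_increasing; lra.
exists (- ln b / 2)%R; first lra.
apply: (Rle_lt_trans _ (b * exp (- ln b / 2))).
  by apply: Rmult_le_compat_r; [exact: Rlt_le (exp_pos _) | exact: Rmax_l].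
rewrite -{1}(exp_ln b); last lra.
rewrite -exp_plus -exp_0; apply: exp_increasing; lra.
Qed.

Lemma exp_INR_mult (x : R) (k : nat) : exp (INR k * x) = (exp x ^ k)%R.
Proof.
elim: k => [|k IH]; first by rewrite Rmult_0_l exp_0.
by rewrite S_INR Rmult_plus_distr_r exp_plus IH Rmult_1_l /=; ring.
Qed.

(** From $(kr)^n/n!\le e^{kr}$ follows $k^n\le (n!/r^n)\,e^{kr}$, so the series is dominated by a
    geometric one of ratio $|t|e^r<1$. *)
Lemma ex_power_sum (t : C) (n : nat) :
  (Cmod t < 1)%R -> exists s, C_series (fun k => RtoC (INR k) ^ n * t ^ k) s.
Proof.
move=> /exists_exp_radius [r r0 hr].
have t0 := Cmod_ge_0 t; have F := INR_fact_lt_0 n; have R0 := pow_lt r n r0.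
set M := (INR (Factorial.fact n) / r ^ n)%R.
apply: (ex_series_le (V := C_CompleteNormedModule) _
  (fun k => (M * (Cmod t * exp r) ^ k)%R)); last first.
  apply: (ex_series_scal (V := R_NormedModule)); apply: ex_series_geom.
  by rewrite Rabs_pos_eq //; apply: Rmult_le_pos => //; exact: Rlt_le (exp_pos _).
move=> k; change (norm _) with (Cmod (RtoC (INR k) ^ n * t ^ k)).
rewrite Cmod_mult !Cmod_pow Cmod_R Rabs_pos_eq; last exact: pos_INR.
rewrite Rpow_mult_distr (Rmult_comm (Cmod t ^ k)) -Rmult_assoc.
apply: Rmult_le_compat_r; first exact: pow_le.
have h := pow_div_fact_le_exp (INR k * r) n (Rmult_le_pos _ _ (pos_INR k) (Rlt_le _ _ r0)).
rewrite -exp_INR_mult.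
have -> : (INR k ^ n = M * ((INR k * r) ^ n / INR (Factorial.fact n)))%R.
  by rewrite /M Rpow_mult_distr; field; lra.
by apply: Rmult_le_compat_l => //; apply: Rlt_le; exact: Rdiv_lt_0_compat.
Qed.

(* Interchange of the two summations in [sum_k t^k sum_n (k u)^n / n!]: the inner
   Taylor remainders are dominated by a geometric series in [k]. *)
Lemma power_sum_egf (t u : C) (S : nat -> C) :
  (forall n, C_series (fun k => RtoC (INR k) ^ n * t ^ k) (S n)) ->
  (Cmod t * exp (3 * Cmod u) < 1)%R ->
  C_series (fun n => u ^ n * (S n / RtoC (INR (Factorial.fact n)))) (/ (1 - t * Cexp u)).
Proof.
move=> HS hq; set q := (_ * _)%R in hq.
have t0 := Cmod_ge_0 t; have u0 := Cmod_ge_0 u.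
have q0 : (0 <= q)%R by apply: Rmult_le_pos => //; exact: Rlt_le (exp_pos _).
have htu : (Cmod (t * Cexp u) < 1)%R.
  apply: Rle_lt_trans hq; rewrite Cmod_mult; apply: Rmult_le_compat_l => //.
  apply: Rle_trans (Cmod_Cexp_le u) _; apply: exp_le; lra.
have geo : is_series (fun k => q ^ k)%R (/ (1 - q))%R.
  by apply: is_series_geom; rewrite Rabs_pos_eq.
set A := fun n => u ^ n * (S n / RtoC (INR (Factorial.fact n))).
(* Truncating the exponential at degree [N] leaves a finite sum over [n], which commutes with the
   series over [k]. *)
have trunc N : C_series (fun k => t ^ k * Cexp_taylor (RtoC (INR k) * u) N) (C_sum A N).
  have term n : C_series
      (fun k => t ^ k * ((RtoC (INR k) * u) ^ n / RtoC (INR (Factorial.fact n)))) (A n).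
    have -> : A n = scal (u ^ n / RtoC (INR (Factorial.fact n)) : C_AbsRing)
                         (S n : C_NormedModule).
      rewrite /A /scal /= /mult /= /Cdiv; ring.
    apply: is_series_ext (is_series_scal (V := C_NormedModule) _ _ _ (HS n)) => k.
    rewrite /scal /= /mult /= Cpow_mult_l /Cdiv; ring.
  elim: N => [|N IH].
    rewrite sum_O; refine (is_series_ext (V := C_NormedModule) _ _ _ _ _); last exact: (term O).
    move=> k /=.
    by rewrite /Cexp_taylor sum_O.
  rewrite sum_Sn; refine (is_series_ext (V := C_NormedModule) _ _ _ _ _);
    last exact: (is_series_plus _ _ _ _ IH (term N.+1)).
  move=> k /=.
  rewrite /Cexp_taylor sum_Sn /plus /=; ring.
(* The truncation error is at most $\sum_k 2^{-(N+1)}q^k=2^{-(N+1)}/(1-q)$, written here as a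
   geometric sequence times a constant. *)
apply: (C_series_of_bound _ _ (fun N => (/ 2) ^ N * (/ 2 / (1 - q)))%R); last first.
  rewrite -(Rmult_0_l (/ 2 / (1 - q))%R).
  apply: (is_lim_seq_scal_r _ _ (Finite 0)); apply: is_lim_seq_geom.
  rewrite Rabs_pos_eq; lra.
move=> N; rewrite -Cmod_opp.
have -> : ((/ 2) ^ N * (/ 2 / (1 - q)) = (/ 2) ^ N.+1 * / (1 - q))%R.
  by rewrite /=; field; lra.
have tail : C_series (fun k => (t * Cexp u) ^ k - t ^ k * Cexp_taylor (RtoC (INR k) * u) N)
    (/ (1 - t * Cexp u) - C_sum A N).
  exact: is_series_minus _ _ _ _ (C_series_geom _ htu) (trunc N).
have dom : is_series (fun k => (/ 2) ^ N.+1 * q ^ k)%R ((/ 2) ^ N.+1 * / (1 - q))%R.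
  exact: (is_series_scal (V := R_NormedModule) _ _ _ geo).
have -> : - (C_sum A N - / (1 - t * Cexp u)) = / (1 - t * Cexp u) - C_sum A N by ring.
apply: C_series_Cmod_le tail dom => k.
have -> : (t * Cexp u) ^ k - t ^ k * Cexp_taylor (RtoC (INR k) * u) N =
    t ^ k * (Cexp (RtoC (INR k) * u) - Cexp_taylor (RtoC (INR k) * u) N).
  rewrite Cexp_nat_mult Cpow_mult_l; ring.
have := Cexp_taylor_remainder_geom (RtoC (INR k) * u) N.
have -> : (3 * Cmod (RtoC (INR k) * u) = INR k * (3 * Cmod u))%R.
  by rewrite Cmod_mult Cmod_R Rabs_pos_eq; [ring | exact: pos_INR].
rewrite exp_INR_mult Cmod_mult Cmod_pow /q Rpow_mult_distr => h.
have -> : ((/ 2) ^ N.+1 * (Cmod t ^ k * exp (3 * Cmod u) ^ k) =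
  Cmod t ^ k * ((/ 2) ^ N.+1 * exp (3 * Cmod u) ^ k))%R by ring.
by apply: Rmult_le_compat_l => //; exact: pow_le.
Qed.

(** The numerator $u$ shifts the index by one, whence the zero coefficient at $0$ and the factor
    $n+1$ from $(n+1)!/n!$. *)
Lemma apostol_bernoulli_expansion_of_power_sums (t : C) (S : nat -> C) :
  (Cmod t < 1)%R ->
  (forall n, C_series (fun k => RtoC (INR k) ^ n * t ^ k) (S n)) ->
  apostol_bernoulli_expansion t
    (fun n => if n is m.+1 then - (RtoC (INR n) * S m) else 0).
Proof.
move=> ht HS.
have [r r0 hr] := exists_exp_radius _ ht.
have t0 := Cmod_ge_0 t.
(* On the disk of radius $r/3$ one has $3|u|<r$, as the interchange of sums requires. *)
have r3 : (0 < r / 3)%R by lra.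
apply: (locally_le_locally_norm (V := C_NormedModule)).
exists (mkposreal _ r3) => u; rewrite /ball_norm /= => hu.
have {}hu : (Cmod u < r / 3)%R.
  by rewrite -(minus_zero_r (u : C_NormedModule)).
have u0 := Cmod_ge_0 u.
have hq : (Cmod t * exp (3 * Cmod u) < 1)%R.
  apply: Rle_lt_trans hr; apply: Rmult_le_compat_l => //; apply: exp_le; lra.
have nz : t * Cexp u - 1 <> 0.
  move=> e; have : (Cmod (t * Cexp u) < 1)%R.
    apply: Rle_lt_trans hq; rewrite Cmod_mult; apply: Rmult_le_compat_l => //.
    apply: Rle_trans (Cmod_Cexp_le u) _; apply: exp_le; lra.
  have -> : t * Cexp u = 1 by rewrite -(Cplus_0_l 1) -e; ring.
  rewrite Cmod_1; lra.
(* The zeroth term vanishes; what remains is $-u$ times the generating function of the power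
   sums. *)
apply/C_pseriesE; apply: (is_series_decr_1 (V := C_NormedModule)).
have -> : plus (u / (t * Cexp u - 1) : C_NormedModule)
   (opp (u ^ 0 * (0 / RtoC (INR (Factorial.fact 0))) : C_NormedModule)) = - u * / (1 - t * Cexp u).
  rewrite /plus /opp /=; field; split => // e; apply: nz.
  have -> : t * Cexp u - 1 = - (1 - t * Cexp u) by ring.
  by rewrite e; ring.
have coef n : - u * (u ^ n * (S n / RtoC (INR (Factorial.fact n)))) =
    u ^ n.+1 * (- (RtoC (INR n.+1) * S n) / RtoC (INR (Factorial.fact n.+1))).
  rewrite fact_simpl mult_INR RtoC_mult Cpow_S; field.
  split; apply: RtoC_neq_0; [exact: INR_fact_neq_0 | exact: not_0_INR].
exact: (is_series_ext (V := C_NormedModule) _ _ _ coef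
  (is_series_scal (V := C_NormedModule) (- u) _ _ (power_sum_egf _ _ _ HS hq))).
Qed.

(** * Uniqueness of power series coefficients *)

(** Beyond the radius of convergence the terms do not tend to $0$, which contradicts convergence at
    [x]. *)
Lemma is_pseries_CV_radius_gt_0 (a : nat -> R) (x l : R) :
  x <> 0%R -> is_pseries a x l -> Rbar_lt 0%R (CV_radius a).
Proof.
move=> x0 Ha; apply: Rbar_not_le_lt => h.
apply: (CV_disk_outside a x).
  apply: Rbar_le_lt_trans h _; exact: Rabs_pos_lt.
apply: (is_lim_seq_ext (fun n => scal (pow_n x n) (a n))).
  by move=> n; rewrite pow_n_pow /scal /= /mult /= Rmult_comm.
by apply: ex_series_lim_0; exists l.
Qed.

Lemma R_pseries_unique (a b : nat -> R) (f : R -> R) :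
  locally 0%R (fun x => is_pseries a x (f x)) ->
  locally 0%R (fun x => is_pseries b x (f x)) -> forall n, a n = b n.
Proof.
move=> Ha Hb n.
have [eps He] := filter_and _ _ Ha Hb.
have e2 : (0 < eps / 2)%R by have := cond_pos eps; lra.
have [ra rb] : is_pseries a (eps / 2)%R (f (eps / 2)%R) /\ is_pseries b (eps / 2)%R (f (eps / 2)%R).
  apply: He; rewrite /ball /= /AbsRing_ball /= /abs /minus /plus /opp /=.
  rewrite Ropp_0 Rplus_0_r Rabs_pos_eq; lra.
apply: PSeries_ext_recip.
- by apply: is_pseries_CV_radius_gt_0 ra; lra.
- by apply: is_pseries_CV_radius_gt_0 rb; lra.
- exists eps => x /He [ha hb].
  by rewrite (is_pseries_unique _ _ _ ha) (is_pseries_unique _ _ _ hb).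
Qed.

Lemma C_pseries_re (a : nat -> C) (x : R) (l : C) :
  C_pseries a (RtoC x) l -> is_pseries (fun n => Re (a n)) x (Re l).
Proof.
move/C_pseriesE => H; apply/is_pseries_R.
apply: (filterlim_ext (fun n => Re (C_sum (fun n => RtoC x ^ n * a n) n))).
  have term k : Re (RtoC x ^ k * a k) = (Re (a k) * x ^ k)%R.
    by rewrite -RtoC_pow re_scal_l Rmult_comm.
  elim=> [|n IH]; first by rewrite !sum_O term.
  by rewrite !sum_Sn -IH -term; exact: re_plus.
apply: filterlim_comp H _ => P [eps HP]; exists eps => y [h _]; exact: HP.
Qed.

(** Restricting [u] to the real axis and taking real parts reduces the claim to real power
    series. *)
Lemma C_pseries_re_unique (a b : nat -> C) (g : C -> C) :
  locally (RtoC 0) (fun u => C_pseries a u (g u)) ->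
  locally (RtoC 0) (fun u => C_pseries b u (g u)) ->
  forall n, Re (a n) = Re (b n).
Proof.
have restrict c : locally (RtoC 0) (fun u => C_pseries c u (g u)) ->
    locally 0%R (fun x => is_pseries (fun n => Re (c n)) x (Re (g (RtoC x)))).
  case=> eps H; exists eps => x hx; apply: C_pseries_re; apply: H.
  by split=> //=; exact: ball_center.
move=> /restrict Ha /restrict Hb.
exact: (R_pseries_unique _ _ (fun x => Re (g (RtoC x))) Ha Hb).
Qed.

(** Real parts agree by the previous lemma; applying it again after multiplication by $i$ gives the
    imaginary parts, since $\mathrm{Re}(iz)=-\mathrm{Im}\,z$. *)
Lemma C_pseries_unique (a b : nat -> C) (g : C -> C) :
  locally (RtoC 0) (fun u => C_pseries a u (g u)) ->
  locally (RtoC 0) (fun u => C_pseries b u (g u)) ->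
  forall n, a n = b n.
Proof.
move=> Ha Hb n.
have rotate c : locally (RtoC 0) (fun u => C_pseries c u (g u)) ->
    locally (RtoC 0) (fun u => C_pseries (fun n => c n * Ci) u (g u * Ci)).
  apply: filter_imp => u /C_pseriesE H; apply/C_pseriesE.
  rewrite Cmult_comm; refine (is_series_ext (V := C_NormedModule) _ _ _ _
    (is_series_scal (V := C_NormedModule) Ci _ _ H)) => k.
  by rewrite Cmult_assoc; exact: Cmult_comm.
have hre := C_pseries_re_unique _ _ _ Ha Hb n.
have := C_pseries_re_unique _ _ _ (rotate _ Ha) (rotate _ Hb) n.
rewrite !re_mult_Ci => him.
by apply: injective_projections => //; apply: Ropp_eq_reg.
Qed.

(** The explicit expansion shows that [epsilon] selects from a nonempty set; the selected sequence
    is thus an expansion as well, and uniqueness identifies the two. *)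
Lemma apostol_bernoulliE (t : C) (S : nat -> C) (n : nat) :
  (Cmod t < 1)%R ->
  (forall n, C_series (fun k => RtoC (INR k) ^ n * t ^ k) (S n)) ->
  apostol_bernoulli n.+1 t = - (RtoC (INR n.+1) * S n).
Proof.
move=> ht HS.
have HB := apostol_bernoulli_expansion_of_power_sums t S ht HS.
have HE : apostol_bernoulli_expansion t (fun n => apostol_bernoulli n t).
  exact: (epsilon_spec (inhabits (fun _ : nat => RtoC 0)) _ (ex_intro _ _ HB)).
have F : RtoC (INR (Factorial.fact n.+1)) <> 0 by apply: RtoC_neq_0; exact: INR_fact_neq_0.
have := C_pseries_unique _ _ _ HE HB n.+1.
move/(f_equal (fun z => z * RtoC (INR (Factorial.fact n.+1)))).
by rewrite /Cdiv -!Cmult_assoc Cinv_l // !Cmult_1_r.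
Qed.

(** * Lyndon words of prime length and the generating function *)

Lemma divisors_prime (p : nat) : prime p -> divisors p = [:: 1; p]%nat.
Proof.
move=> hp; have p1 := prime_gt1 hp.
apply: (irr_sorted_eq ltn_trans ltnn); first exact: sorted_divisors_ltn.
  by rewrite /= p1.
move=> d; rewrite -dvdn_divisors ?prime_gt0 // !inE.
apply/idP/idP; first by case/primeP: hp => _; exact.
by case/orP=> /eqP ->; [exact: dvd1n | exact: dvdnn].
Qed.

(** Only the divisors $1$ and $p$ contribute, with $\mu(p)=-1$ and $\mu(1)=1$ respectively. *)
Lemma lyndon_prime (k p : nat) :
  prime p -> lyndon k p = ((INR k ^ p - INR k) / INR p)%R.
Proof.
move=> hp; rewrite /lyndon divisors_prime // !big_cons big_nil.
rewrite divn1 divnn prime_gt0 //= /mobius primes_prime //= logn_prime // eqxx /=.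
have -> : Z.pow_pos (-1) 1 = (-1)%Z by [].
rewrite /Rdiv; ring.
Qed.

Theorem theorem3 (p : nat) (t : C) (hp : prime p) (ht : (Cmod t < 1)%R) :
  is_lyndon_gf t p
    (apostol_bernoulli 2 t / (2 * RtoC (INR p))
     - apostol_bernoulli p.+1 t / (RtoC (INR p) * RtoC (INR p.+1)))%C.
Proof.
have ex n := constructive_indefinite_description _ (ex_power_sum t n ht).
set S := fun n => proj1_sig (ex n).
have HS n : C_series (fun k => RtoC (INR k) ^ n * t ^ k) (S n) := proj2_sig (ex n).
have p0 : INR p <> 0%R by apply: not_0_INR; case: (p) hp.
have p1 : INR p.+1 <> 0%R by exact: not_0_INR.
have P0 := RtoC_neq_0 _ p0; have P1 := RtoC_neq_0 _ p1.
rewrite !(apostol_bernoulliE t S) //.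
(* The factors $2$ and $p+1$ from $\mathcal{B}_2=-2S_1$ and $\mathcal{B}_{p+1}=-(p+1)S_p$ cancel
   against the denominators. *)
have -> : - (RtoC (INR 2) * S 1%nat) / (2 * RtoC (INR p)) -
    - (RtoC (INR p.+1) * S p) / (RtoC (INR p) * RtoC (INR p.+1)) =
    / RtoC (INR p) * (S p - S 1%nat).
  have -> : INR 2 = 2%R by [].
  by field.
apply/C_pseriesE.
have coef k : / RtoC (INR p) * (RtoC (INR k) ^ p * t ^ k - RtoC (INR k) ^ 1 * t ^ k) =
    t ^ k * RtoC (lyndon k p).
  rewrite lyndon_prime // RtoC_div // RtoC_minus RtoC_pow Cpow_1_r; field.
  exact: P0.
exact: (is_series_ext (V := C_NormedModule) _ _ _ coef
  (is_series_scal (V := C_NormedModule) (/ RtoC (INR p)) _ _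
    (is_series_minus (V := C_NormedModule) _ _ _ _ (HS p) (HS 1%nat)))).
Qed.
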